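(* Let $k\geq 1$, let $P\in\mathbb{Q}[X_{1},\ldots,X_{k}]$ be a polynomial of absolute degree $r$, and let $V=\{(X_{1},\ldots,X_{k})\in\mathbb{R}^{k}: P(X_{1},\ldots,X_{k})=0\}$. Let $\mathscr{T}:=V\cap\mathbb{Q}^{k}$ be the set of rational points on $V$. Let $\psi:\mathbb{R}\to\mathbb{R}$ be any function with $\psi(t)=o(t^{-r+1})$ as $t\to\infty$. Then \[ \mathscr{T}\subseteq \mathscr{H}^{k}_{\psi}\cap V\subseteq \overline{\mathscr{T}}, \] where $\overline{\mathscr{T}}$ denotes the topological closure of $\mathscr{T}$ in $\mathbb{R}^{k}$ with respect to the Euclidean metric.
   Context: For a nonzero monomial $aX_{1}^{j_{1}}\cdots X_{k}^{j_{k}}$ ($a\in\mathbb{Q}\setminus\{0\}$) its total degree is $j_{1}+\cdots+j_{k}$; the absolute degree of $P\in\mathbb{Q}[X_{1},\ldots,X_{k}]$ is the maximum of the total degrees of the monomials occurring in $P$. For a function $\psi:\mathbb{R}\to\mathbb{R}$, $\mathscr{H}^{k}_{\psi}\subseteq\mathbb{R}^{k}$ is the set of $\underline{\zeta}=(\zeta_{1},\ldots,\zeta_{k})$ such that the inequality $\max_{1\leq j\leq k}\vert x\zeta_{j}-y_{j}\vert\leq\psi(x)$ has a solution $(x,y_{1},\ldots,y_{k})\in\mathbb{Z}^{k+1}$ for arbitrarily large values of $x$.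
   Formalization: The first inclusion is stated only for ψ with ψ(t) ≥ 0 for all large t, since it fails for negative ψ (k=1, P=X_1, ψ(t)=-exp(-t): the set of approximable points is empty but 0 is a rational point on V); the second inclusion is for arbitrary ψ. *)

(* Defs.v *)
From HB Require Import structures.
From mathcomp Require Import all_boot all_order all_algebra.
From mathcomp Require Import all_classical all_reals all_analysis.
(* Not imported: its notations clash with those of mathcomp-analysis. *)
From mathcomp Require mpoly.

Set Implicit Arguments.
Unset Strict Implicit.
Unset Printing Implicit Defensive.
Import Order.TTheory GRing.Theory Num.Theory.
Import numFieldNormedType.Exports.
Local Open Scope classical_set_scope.
Local Open Scope ring_scope.

(* Lets the little-o notation accept the filter +oo. *)
Canonical pinfty_filter_on (R : numFieldType) : filter_on R :=
  FilterType (pinfty_nbhs R) (@proper_pinfty_nbhs R).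

(* R^k is 'rV[R]_k; its library topology is the product topology, which is the
   one induced by the Euclidean metric. *)

(* The zero polynomial, which has no monomials, gets degree 0. *)
Definition absolute_degree (k : nat) (P : mpoly.mpoly k rat) : nat :=
  \max_(m <- mpoly.msupp P) mpoly.mdeg m.

Definition zero_locus (R : realType) (k : nat) (P : mpoly.mpoly k rat) :
    set 'rV[R]_k :=
  [set X | mpoly.meval (fun i => X ord0 i) (mpoly.map_mpoly ratr P) = 0].

Definition rational_points (R : realType) (k : nat) : set 'rV[R]_k :=
  range (fun q : 'rV[rat]_k => map_mx ratr q).

(* The default value 0 of the maximum is irrelevant for 0 < k, as all the
   entries are nonnegative. *)
Definition psi_approximable (R : realType) (k : nat) (psi : R -> R) :
    set 'rV[R]_k :=
  [set zeta | forall N : int, exists2 x : int, N < x &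
     exists y : 'rV[int]_k,
       \big[Num.max/0]_(j < k) `|x%:~R * zeta ord0 j - (y ord0 j)%:~R|
         <= psi x%:~R].

(* Main.v *)
(* If [y / x] approximates a zero [z] of [P] within [psi x / x = o(x ^- r)], then
   [P (y / x) = o(x ^- r)] since [P] is Lipschitz near [z]. But [x ^+ r * P (y / x)]
   lies in [D^-1 Z] for a constant [D], so [P (y / x) = 0] once [x] is large, and
   the rational zeros [y / x] converge to [z]. Conversely, every multiple [x] of
   the common denominator of a rational point gives an exact solution. *)
Require Import Defs.
From mathcomp Require Import all_boot all_order all_algebra.
From mathcomp Require Import all_classical all_reals all_analysis.
From mathcomp Require mpoly.
Import (canonicals) mpoly.
From mathcomp Require Import lra ring.
Import Order.TTheory GRing.Theory Num.Theory.
Import numFieldNormedType.Exports.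
Local Open Scope classical_set_scope.
Local Open Scope ring_scope.

Lemma meval_map_ratr (F : numFieldType) (k : nat) (P : mpoly.mpoly k rat)
    (v : 'I_k -> F) :
  mpoly.meval v (mpoly.map_mpoly ratr P) =
  \sum_(m <- mpoly.msupp P)
     ratr (mpoly.mcoeff m P) * \prod_i v i ^+ mpoly.fun_of_multinom m i.
Proof.
rewrite mpoly.mevalE.
rewrite (perm_big _ (mpoly.msupp_map_mpoly P (fmorph_inj ratr))) /=.
by apply: eq_bigr => m _; rewrite mpoly.mcoeff_map_mpoly.
Qed.

Lemma mdeg_le_absolute_degree (k : nat) (P : mpoly.mpoly k rat) m :
  m \in mpoly.msupp P -> (mpoly.mdeg m <= absolute_degree P)%N.
Proof. by move=> mP; rewrite /absolute_degree (big_rem m) //= leq_maxl. Qed.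

Section LipschitzAt.
Context {R : realFieldType} {k : nat}.
Implicit Types (z q : 'I_k -> R) (f g : ('I_k -> R) -> R).

(** The point [z] is fixed and [d] is at most 1 because a polynomial has in general no global
    Lipschitz constant, while this local form is stable under products. Closeness is coordinatewise,
    as in [psi_approximable]. *)
Definition lipschitz_at z f := exists2 C : R, 0 <= C &
  forall d q, 0 <= d -> d <= 1 -> (forall i, `|q i - z i| <= d) ->
    `|f q - f z| <= C * d.

Lemma lipschitz_at_cst z c : lipschitz_at z (fun=> c).
Proof. by exists 0 => // d q _ _ _; rewrite subrr normr0 mul0r. Qed.

Lemma lipschitz_at_coord z i : lipschitz_at z (fun q => q i).
Proof. by exists 1 => // d q _ _ /(_ i); rewrite mul1r. Qed.

Lemma lipschitz_atD z f g :
  lipschitz_at z f -> lipschitz_at z g -> lipschitz_at z (fun q => f q + g q).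
Proof.
move=> [A A0 Af] [B B0 Bg]; exists (A + B); first exact: addr_ge0.
move=> d q d0 d1 qz; rewrite opprD addrACA mulrDl.
by apply: le_trans (ler_normD _ _) _; rewrite lerD ?Af ?Bg.
Qed.

Lemma lipschitz_atM z f g :
  lipschitz_at z f -> lipschitz_at z g -> lipschitz_at z (fun q => f q * g q).
Proof.
(* The two terms come from the splitting of the difference below; [d <= 1] bounds the factor [f q]
   by [|f z| + A]. *)
move=> [A A0 Af] [B B0 Bg]; exists ((`|f z| + A) * B + `|g z| * A).
  by rewrite !(addr_ge0, mulr_ge0).
move=> d q d0 d1 qz; have fd := Af d q d0 d1 qz; have gd := Bg d q d0 d1 qz.
have -> : f q * g q - f z * g z = f q * (g q - g z) + g z * (f q - f z) by ring.
have fq : `|f q| <= `|f z| + A.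
  rewrite -[f q](subrK (f z)) addrC (le_trans (ler_normD _ _)) // lerD2l.
  by rewrite (le_trans fd) // ler_piMr.
apply: le_trans (ler_normD _ _) _; rewrite !normrM [leRHS]mulrDl -!mulrA.
by apply: lerD; [exact: ler_pM | exact: ler_wpM2l].
Qed.

Lemma lipschitz_at_sum (I : Type) (s : seq I) z (F : I -> ('I_k -> R) -> R) :
  (forall i, lipschitz_at z (F i)) ->
  lipschitz_at z (fun q => \sum_(i <- s) F i q).
Proof.
move=> Fz; elim: s => [|i s IHs].
  by under eq_fun do rewrite big_nil; exact: lipschitz_at_cst.
by under eq_fun do rewrite big_cons; exact: lipschitz_atD.
Qed.

Lemma lipschitz_at_prod (I : Type) (s : seq I) z (F : I -> ('I_k -> R) -> R) :
  (forall i, lipschitz_at z (F i)) ->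
  lipschitz_at z (fun q => \prod_(i <- s) F i q).
Proof.
move=> Fz; elim: s => [|i s IHs].
  by under eq_fun do rewrite big_nil; exact: lipschitz_at_cst.
by under eq_fun do rewrite big_cons; exact: lipschitz_atM.
Qed.

Lemma lipschitz_atX z f n :
  lipschitz_at z f -> lipschitz_at z (fun q => f q ^+ n).
Proof.
move=> fz; elim: n => [|n IHn].
  by under eq_fun do rewrite expr0; exact: lipschitz_at_cst.
by under eq_fun do rewrite exprS; exact: lipschitz_atM.
Qed.

Lemma lipschitz_at_meval (P : mpoly.mpoly k rat) z :
  lipschitz_at z (fun q => mpoly.meval q (mpoly.map_mpoly ratr P)).
Proof.
under eq_fun do rewrite meval_map_ratr.
apply: lipschitz_at_sum => m; apply: lipschitz_atM; first exact: lipschitz_at_cst.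
by apply: lipschitz_at_prod => i; apply/lipschitz_atX/lipschitz_at_coord.
Qed.

End LipschitzAt.

Lemma denq_ratr_int (F : archiRealFieldType) (a : rat) :
  (denq a)%:~R * ratr a \is a @Num.int F.
Proof. by rewrite /ratr mulrC divfK ?intr_eq0 ?denq_neq0 ?intr_int. Qed.

(* Clearing denominators: a monomial of degree [d <= r] in the [y i / x] becomes
   an integer after multiplication by [x ^+ r]. *)
Lemma meval_common_denominator (F : archiRealFieldType) (k : nat)
    (P : mpoly.mpoly k rat) (r : nat) : (absolute_degree P <= r)%N ->
  exists2 D : int, 0 < D & forall (x : int) (y : 'I_k -> int), x != 0 ->
    D%:~R * x%:~R ^+ r *
      mpoly.meval (fun i => (y i)%:~R / x%:~R) (mpoly.map_mpoly ratr P)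
    \is a @Num.int F.
Proof.
(* A plain product of the denominators suffices: for each monomial its own denominator splits off
   and the rest [Q] stays an integer. *)
move=> degP; exists (\prod_(m <- mpoly.msupp P) denq (mpoly.mcoeff m P)).
  by apply: prodr_gt0 => m _; exact: denq_gt0.
move=> x y x0; have xF : x%:~R != 0 :> F by rewrite intr_eq0.
rewrite meval_map_ratr mulr_sumr big_seq rpred_sum // => m mP.
have mr := leq_trans (mdeg_le_absolute_degree _ _ _ mP) degP.
rewrite (big_rem m) //=.
set c := mpoly.mcoeff m P; set Q := \prod_(_ <- rem _ _) _.
have -> : \prod_i ((y i)%:~R / x%:~R) ^+ mpoly.fun_of_multinom m i =
    \prod_i (y i)%:~R ^+ mpoly.fun_of_multinom m i / x%:~R ^+ mpoly.mdeg m :> F.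
  under eq_bigr do rewrite expr_div_n.
  by rewrite prodf_div mpoly.mdegE -prodrXr.
set Y : F := \prod_i _.
(* Each factor on the right is an integer; the exponent [r - mpoly.mdeg m] is a true difference
   thanks to [mr]. *)
have -> : (denq c * Q)%:~R * x%:~R ^+ r * (ratr c * (Y / x%:~R ^+ mpoly.mdeg m)) =
    (denq c)%:~R * ratr c * Q%:~R * Y * x%:~R ^+ (r - mpoly.mdeg m) :> F.
  rewrite -{1}(subnK mr) exprD intrM; field.
  by rewrite expf_neq0.
apply: rpredM; last by rewrite rpredX ?intr_int.
apply: rpredM; last by apply: rpred_prod => i _; rewrite rpredX ?intr_int.
by apply: rpredM; [exact: denq_ratr_int | exact: intr_int].
Qed.

(** Serves to pass at once the real threshold of a property holding near [+oo] and an integer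
    bound. *)
Lemma exists_int_gt (F : archiRealFieldType) (M : F) (N : int) :
  exists n : int, [/\ 0 < n, N < n & M < n%:~R].
Proof.
exists (Num.max 0 (Num.max N (Num.floor M)) + 1).
rewrite !ltzD1 !le_max !lexx ?orbT; split=> //.
by rewrite (lt_le_trans (floorD1_gt M)) // ler_int lerD2r !le_max lexx !orbT.
Qed.

Section Inclusions.
Context {R : realType} {k : nat}.

(** Exact solutions have error 0, so [psi] only has to be nonnegative at large arguments. Where
    [psi] is negative, not even an exact solution is admissible. *)
Lemma rational_psi_approximable (psi : R -> R) :
  (\forall t \near +oo, 0 <= psi t) ->
  @rational_points R k `<=` @psi_approximable R k psi.
Proof.
move=> [M [_ psi0]] _ [q _ <-] N.
pose D := \prod_(j < k) denq (q ord0 j).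
have D0 : 0 < D by apply: prodr_gt0 => j _; exact: denq_gt0.
have [n [n0 Nn Mn]] := exists_int_gt _ M N.
have nx : n <= D * n by rewrite ler_peMl ?(ltW n0) // -gtz0_ge1.
exists (D * n); first exact: lt_le_trans nx.
(* The floor rounds nothing: its argument is already an integer, since [D] is a multiple of each
   denominator. *)
exists (\row_j Num.floor ((D * n)%:~R * (ratr (q ord0 j)) : R)).
apply: bigmax_le => [|j _].
  by apply: psi0; rewrite (lt_le_trans Mn) // ler_int.
rewrite !mxE [X in _ - X]floorK ?subrr ?normr0.
  by apply: psi0; rewrite (lt_le_trans Mn) // ler_int.
rewrite /D (bigD1 j) //=; set E := \prod_(_ < _ | _) _.
rewrite -mulrA intrM mulrAC.
by apply: rpredM; [exact: denq_ratr_int | exact: intr_int].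
Qed.

Lemma approximable_zero_closure (P : mpoly.mpoly k rat) (psi : R -> R) :
  psi =o_+oo (fun t : R => t ^ (1 - (absolute_degree P)%:Z)) ->
  @psi_approximable R k psi `&` zero_locus P `<=`
    closure (zero_locus P `&` @rational_points R k).
Proof.
move=> /eqoP psio z [zpsi Pz] B /nbhs_ballP[e e0 zeB].
set r := absolute_degree P in psio *.
have [C C0 PC] := lipschitz_at_meval P (z ord0).
have [D D0 DP] := meval_common_denominator R k P r (leqnn _).
have DR : 0 < D%:~R :> R by rewrite ltr0z.
have DC : 0 < D%:~R * C + 1 by rewrite ltr_wpDl // mulr_ge0 // ltW.
(* The three bounds serve the range of the Lipschitz estimate, membership in the ball of radius [e],
   and [D * C * eps < 1]. The [+ 1] keeps the inverse meaningful when [C = 0]. *)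
pose eps := Num.min 1 (Num.min (e / 2) ((D%:~R * C + 1)^-1)).
have eps0 : 0 < eps by rewrite !lt_min ltr01 divr_gt0 ?invr_gt0.
have eps1 : eps <= 1 by rewrite ge_min lexx.
have epse : eps < e.
  by rewrite !gt_min [e / 2 < e]ltr_pdivrMr ?ltr_pMr ?ltr1n ?orbT.
have epsD : D%:~R * C * eps < 1.
  have : eps <= (D%:~R * C + 1)^-1 by rewrite !ge_min lexx !orbT.
  by rewrite -(ler_pM2l DC) divff ?gt_eqF //; lra.
have [M [_ psiM]] := psio _ eps0.
have [n [n0 _ Mn]] := exists_int_gt _ M 0.
have [x nx [y xy]] := zpsi n.
have x0 : 0 < x := lt_trans n0 nx.
have x0R : 0 < x%:~R :> R by rewrite ltr0z.
have Mx : M < x%:~R by rewrite (lt_trans Mn) // ltr_int.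
(* This is the bound [eps * x ^ (1 - r)] on [psi x], divided by [x]. *)
pose d := eps / x%:~R ^+ r.
have d0 : 0 <= d by rewrite divr_ge0 ?exprn_ge0 // ltW.
have deps : d <= eps.
  by rewrite ler_piMr ?(ltW eps0) // invf_le1 ?exprn_gt0 // exprn_ege1 // ler1z -gtz0_ge1.
pose q (j : 'I_k) := (y ord0 j)%:~R / x%:~R : R.
have qz j : `|q j - z ord0 j| <= d.
  have : `|x%:~R * z ord0 j - (y ord0 j)%:~R| <= eps * `|x%:~R ^ (1 - r%:Z)|.
    apply: le_trans (le_trans (ler_norm _) (psiM _ Mx)).
    apply: le_trans xy; exact: le_bigmax.
  rewrite [`|_ ^ _|]gtr0_norm ?exprz_gt0 // expfzDr ?gt_eqF // expr1z -exprnN.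
  have -> : q j - z ord0 j = - ((x%:~R * z ord0 j - (y ord0 j)%:~R) / x%:~R).
    by rewrite /q; field; rewrite gt_eqF.
  rewrite normrN normrM normfV (gtr0_norm x0R) ler_pdivrMr //.
  by move=> /le_trans; apply; rewrite /d -mulrA [x%:~R * _]mulrC.
have Pq0 : mpoly.meval q (mpoly.map_mpoly ratr P) = 0.
  have Pd := PC d q d0 (le_trans deps eps1) qz.
  have {Pz} Pz : mpoly.meval (z ord0) (mpoly.map_mpoly ratr P) = 0 := Pz.
  rewrite Pz subr0 in Pd.
  have DX : 0 < D%:~R * x%:~R ^+ r :> R by rewrite mulr_gt0 ?exprn_gt0.
  have xn0 : x != 0 by rewrite gt_eqF.
  (* A nonzero integer has absolute value at least 1, but here the Lipschitz bound gives at most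
     [D * x ^+ r * (C * d) = D * C * eps < 1]. *)
  apply: contraTeq (DP x (y ord0) xn0) => Pn0; apply/negP => /norm_intr_ge1.
  rewrite mulf_neq0 ?(lt0r_neq0 DX) // => /(_ isT); apply/negP; rewrite -ltNge.
  rewrite normrM (gtr0_norm DX); apply: le_lt_trans epsD.
  rewrite -(ler_pM2l DX) in Pd; apply: le_trans Pd _.
  by rewrite mulrACA [_ ^+ r * _]mulrC divfK // expf_neq0 // lt0r_neq0.
exists (\row_j q j); split.
  split; first by rewrite /zero_locus /= -[RHS]Pq0; apply: mpoly.meval_eq => j; rewrite mxE.
  exists (\row_j ((y ord0 j)%:~R / x%:~R)) => //.
  by apply/rowP => j; rewrite !mxE fmorph_div /= !ratr_int.
apply: zeB; split=> // i j; rewrite (ord1 i) mxE /ball /= distrC.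
exact: le_lt_trans (qz j) (le_lt_trans deps epse).
Qed.

End Inclusions.

Theorem theorem2p1 (R : realType) (k : nat) (hk : (1 <= k)%N)
    (P : mpoly.mpoly k rat) (r : nat) (hr : absolute_degree P = r)
    (psi : R -> R) (hpsi : psi =o_+oo (fun t : R => t ^ (1 - r%:Z))) :
  let V : set 'rV[R]_k := zero_locus P in
  let T : set 'rV[R]_k := V `&` @rational_points R k in
  ((\forall t \near +oo, 0 <= psi t) -> T `<=` @psi_approximable R k psi `&` V)
  /\ @psi_approximable R k psi `&` V `<=` closure T.
Proof.
subst r; split; last exact: approximable_zero_closure.
move=> psi0 z [Vz Qz]; split=> //; exact: rational_psi_approximable Qz.
Qed.
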